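(* Let $\lambda=(\lambda_1,\dots,\lambda_n)$ be a partition with positive parts and $m=\lambda_1$. Then the $m+n-1$ polynomials $$\sum_{i\ge1,\ k+i\le\lambda_i} x_iy_{k+i}\quad(k=0,\dots,m-1),\qquad \sum_{i\ge1,\ k+i\le n,\ i\le\lambda_{k+i}} x_{k+i}y_i\quad(k=1,\dots,n-1)$$ (the ''diagonals'' of the Ferrers tableau, each summand being a monomial generator of $I_\lambda$) generate a minimal reduction $J_\lambda$ of the Ferrers ideal $I_\lambda$.
   Context: Let $K$ be a field. For a partition $\lambda=(\lambda_1\ge\cdots\ge\lambda_n)$ with positive parts and $m=\lambda_1$, the Ferrers ideal is $I_\lambda=(x_iy_j:1\le i\le n,\ 1\le j\le\lambda_i)\subset K[x_1,\dots,x_n,y_1,\dots,y_m]$. An ideal $J\subset I$ is a reduction of $I$ if $I^{r+1}=JI^r$ for some $r\ge0$; it is a minimal reduction if no ideal strictly contained in $J$ is a reduction of $I$. *)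

(* Defs.v *)
From HB Require Import structures.
From mathcomp Require Import all_boot all_order all_algebra.
Set Implicit Arguments. Unset Strict Implicit. Unset Printing Implicit Defensive.
Import GRing.Theory.
Local Open Scope ring_scope.

Fixpoint mpoly (R : comNzRingType) (k : nat) : comNzRingType :=
  match k with
  | 0 => R
  | k'.+1 => GRing.ComNzRing.clone {poly (mpoly R k')} _
  end.

(* the variable z_j of mpoly R k (0-based, j < k); z_{k-1} is the outermost 'X *)
Fixpoint mvar (R : comNzRingType) (k j : nat) : mpoly R k :=
  match k return mpoly R k with
  | 0 => 0
  | k'.+1 => if j == k' then ('X : {poly mpoly R k'}) else (mvar R k' j)%:P
  end.

Section Ideals.
Variable R : comNzRingType.

Definition is_ideal (I : R -> Prop) : Prop :=
  [/\ I 0, (forall a b, I a -> I b -> I (a + b)) & (forall r a, I a -> I (r * a))].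

Definition ideal_gen (S : R -> Prop) : R -> Prop :=
  fun x => exists s : seq (R * R),
      (forall p, p \in s -> S p.2) /\ x = \sum_(p <- s) p.1 * p.2.

Definition ideal_of_seq (g : seq R) : R -> Prop := ideal_gen (fun x => x \in g).

Definition ideal_mul (I J : R -> Prop) : R -> Prop :=
  ideal_gen (fun x => exists a b, [/\ I a, J b & x = a * b]).

Fixpoint ideal_pow (I : R -> Prop) (r : nat) : R -> Prop :=
  match r with
  | 0 => fun _ => True
  | r'.+1 => ideal_mul I (ideal_pow I r')
  end.

Definition ideal_sub (I J : R -> Prop) : Prop := forall x, I x -> J x.
Definition ideal_eq (I J : R -> Prop) : Prop := forall x, I x <-> J x.

Definition is_reduction (J I : R -> Prop) : Prop :=
  is_ideal J /\ ideal_sub J I /\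
  exists r : nat, ideal_eq (ideal_pow I r.+1) (ideal_mul J (ideal_pow I r)).

Definition is_minimal_reduction (J I : R -> Prop) : Prop :=
  is_reduction J I /\
  forall J' : R -> Prop, is_ideal J' -> ideal_sub J' J -> ~ ideal_eq J' J ->
    ~ is_reduction J' I.

End Ideals.

(* Ferrers setting, 0-based: lam = [:: λ_1; ...; λ_n], n = size lam, m = λ_1.
   Ring K[x_0..x_{n-1}, y_0..y_{m-1}] = mpoly K (n+m), x_a = z_a, y_b = z_{n+b}. *)
Definition FRing (K : fieldType) (lam : seq nat) : comNzRingType :=
  mpoly K (size lam + head 0%N lam).

Definition fx (K : fieldType) (lam : seq nat) (a : nat) : FRing K lam :=
  mvar K (size lam + head 0%N lam) a.
Definition fy (K : fieldType) (lam : seq nat) (b : nat) : FRing K lam :=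
  mvar K (size lam + head 0%N lam) (size lam + b).

Definition is_partition (lam : seq nat) : Prop :=
  sorted geq lam /\ all (fun l => 0 < l)%N lam.

Definition ferrers_gens (K : fieldType) (lam : seq nat) : seq (FRing K lam) :=
  [seq fx K lam a * fy K lam b | a <- iota 0 (size lam), b <- iota 0 (nth 0%N lam a)].

Definition ferrers_ideal (K : fieldType) (lam : seq nat) : FRing K lam -> Prop :=
  ideal_of_seq (ferrers_gens K lam).

(* upper diagonal k (k = 0..m-1): sum_{i>=1, k+i<=λ_i} x_i y_{k+i}  (1-based);
   0-based: sum over a < n with a + k < λ_a of x_a y_{a+k} *)
Definition diagU (K : fieldType) (lam : seq nat) (k : nat) : FRing K lam :=
  \sum_(a <- iota 0 (size lam) | (a + k < nth 0%N lam a)%N) fx K lam a * fy K lam (a + k).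

(* lower diagonal k (k = 1..n-1): sum_{i>=1, k+i<=n, i<=λ_{k+i}} x_{k+i} y_i (1-based);
   0-based: sum over b with k + b < n and b < λ_{k+b} of x_{k+b} y_b *)
Definition diagL (K : fieldType) (lam : seq nat) (k : nat) : FRing K lam :=
  \sum_(b <- iota 0 (size lam) | (k + b < size lam)%N && (b < nth 0%N lam (k + b))%N)
     fx K lam (k + b) * fy K lam b.

Definition diag_gens (K : fieldType) (lam : seq nat) : seq (FRing K lam) :=
  [seq diagU K lam k | k <- iota 0 (head 0%N lam)] ++
  [seq diagL K lam k | k <- iota 1 (size lam).-1].

Definition diag_ideal (K : fieldType) (lam : seq nat) : FRing K lam -> Prop :=
  ideal_of_seq (diag_gens K lam).

Arguments ferrers_ideal K lam _ : clear implicits.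
Arguments diag_ideal K lam _ : clear implicits.

(* Main.v *)
(** Reduction.  Let [x_i y_j] be a cell of the tableau and [D] its diagonal.  Modulo [J I^r], the
    square of the cell is minus the sum of its products with the other cells of [D], and each such
    product equals the product of the two opposite corners of a rectangle, which lie on either side
    of [D].  This raises the sum of the squares of the diagonal indices of a word of cells, so every
    word long enough to repeat a cell lies in [J I^r].

    Minimality.  Let [J'] be strictly contained in [J] with [I^(r+1) = J' I^r].  There are a point
    [ev : R -> k] and a nonzero [ev]-semilinear functional [phi] on [J] that kills [J'].  If [I]
    does not vanish at the point, semilinearity gives a contradiction at once.  Otherwise one builds
    a two-parameter arc [R -> k[s][t]] through the point at [t = 0] along which [I] has order 2 in
    [t] and the [t^2]-coefficient of every [z] in [J] is [const + phi z * s] modulo a high power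
    of [s].  On [J'] it is constant, so [z I^r <= J' I^r] makes the leading coefficients of the
    generators of [I^r] an eigenvector with eigenvalue [s] of a matrix over [k] modulo that power,
    which the characteristic polynomial forbids.

    To build the arc, let [p] be the number of rows [i] having a cell [(i, j)] with [y_j] nonzero at
    the point, and define [q] dually for columns.  The variables [x_i] ([i < p]) and [y_j] ([j < q])
    lie in [J] locally, and they get the value of [phi] as their [t^2]-coefficient.  What remains is
    a smaller Ferrers tableau, on which the system "diagonals = given values" is solved by Newton
    iteration. *)
Require Import Defs.
From HB Require Import structures.
From mathcomp Require Import all_boot all_order all_algebra.
From mathcomp Require Import boolp classical_sets.
From mathcomp Require Import ring_quotient generic_quotient.
From mathcomp Require Import zify ring.
Set Implicit Arguments. Unset Strict Implicit. Unset Printing Implicit Defensive.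
Import GRing.Theory.
Local Open Scope ring_scope.

(** * Ideals and their powers *)

Definition fam_ideal (R : comNzRingType) (T : Type) (g : T -> R) : R -> Prop :=
  ideal_gen (fun z => exists t, z = g t).

Lemma ideal0 (R : comNzRingType) (I : R -> Prop) : is_ideal I -> I 0.
Proof. by case. Qed.

Lemma idealD (R : comNzRingType) (I : R -> Prop) a b :
  is_ideal I -> I a -> I b -> I (a + b).
Proof. by case=> _ + _; apply. Qed.

Lemma idealM (R : comNzRingType) (I : R -> Prop) r a :
  is_ideal I -> I a -> I (r * a).
Proof. by case=> _ _; apply. Qed.

Lemma idealMl (R : comNzRingType) (I : R -> Prop) r a :
  is_ideal I -> I a -> I (a * r).
Proof. by rewrite mulrC; apply: idealM. Qed.

Lemma idealN (R : comNzRingType) (I : R -> Prop) a : is_ideal I -> I a -> I (- a).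
Proof. by rewrite -mulN1r; apply: idealM. Qed.

Lemma idealB (R : comNzRingType) (I : R -> Prop) a b :
  is_ideal I -> I a -> I b -> I (a - b).
Proof. by move=> iI Ia Ib; apply: idealD => //; apply: idealN. Qed.

Lemma ideal_sum (R : comNzRingType) (I : R -> Prop) (T : Type) (s : seq T)
    (P : pred T) (F : T -> R) :
  is_ideal I -> (forall t, P t -> I (F t)) -> I (\sum_(t <- s | P t) F t).
Proof.
move=> iI IF; elim/big_ind: _ => //; first exact: ideal0.
by move=> a b; apply: idealD.
Qed.

Lemma ideal_gen_is_ideal (R : comNzRingType) (S : R -> Prop) :
  is_ideal (ideal_gen S).
Proof.
split.
- by exists [::]; rewrite big_nil.
- move=> _ _ [s [Ss ->]] [t [St ->]]; exists (s ++ t); rewrite big_cat.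
  by split=> // p; rewrite mem_cat => /orP[/Ss|/St].
- move=> r _ [s [Ss ->]]; exists [seq (r * p.1, p.2) | p <- s]; split.
    by move=> _ /mapP[p /Ss Sp ->].
  by rewrite big_map mulr_sumr; apply: eq_bigr => p _; rewrite mulrA.
Qed.

Lemma mem_ideal_gen (R : comNzRingType) (S : R -> Prop) z : S z -> ideal_gen S z.
Proof.
move=> Sz; exists [:: (1, z)]; rewrite big_seq1 mul1r; split=> // p.
by rewrite inE => /eqP ->.
Qed.

Lemma ideal_gen_sub (R : comNzRingType) (S I : R -> Prop) :
  is_ideal I -> (forall z, S z -> I z) -> ideal_sub (ideal_gen S) I.
Proof.
move=> iI SI _ [s [Ss ->]]; rewrite big_seq.
by apply: ideal_sum => // p /Ss/SI; apply: idealM.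
Qed.

Lemma ideal_mul_mem (R : comNzRingType) (I J : R -> Prop) a b :
  I a -> J b -> ideal_mul I J (a * b).
Proof. by move=> Ia Jb; apply: mem_ideal_gen; exists a, b. Qed.

Lemma ideal_mul_mono (R : comNzRingType) (I I' J : R -> Prop) :
  ideal_sub I I' -> ideal_sub (ideal_mul I J) (ideal_mul I' J).
Proof.
move=> II'; apply: ideal_gen_sub; first exact: ideal_gen_is_ideal.
by move=> _ [a [b [/II' Ia Jb ->]]]; apply: ideal_mul_mem.
Qed.

Lemma is_ideal_transporter (R : comNzRingType) (I : R -> Prop) (a : R) :
  is_ideal I -> is_ideal (fun b => I (a * b)).
Proof.
move=> iI; split; first by rewrite mulr0; apply: ideal0.
  by move=> b c Ib Ic; rewrite mulrDr; apply: idealD.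
by move=> r b Ib; rewrite mulrCA; apply: idealM.
Qed.

(** A product is tested one factor at a time: with the other factor fixed, the transporter ideal
    reduces membership to generators. *)
Lemma ideal_pow_sub (R : comNzRingType) (T : Type) (g : T -> R) (N : nat)
    (I : R -> Prop) :
  is_ideal I ->
  (forall w : seq T, size w = N -> I (\prod_(t <- w) g t)) ->
  ideal_sub (ideal_pow (fam_ideal g) N) I.
Proof.
elim: N I => [|N IH] I iI Iw x.
  by move=> _; rewrite -[x]mulr1; apply: idealM => //; have := Iw [::] erefl; rewrite big_nil.
apply: ideal_gen_sub => // _ [a [b [Ia Ib ->]]]; rewrite mulrC; move: a Ia.
apply: ideal_gen_sub; first exact: is_ideal_transporter.
move=> _ [t ->]; rewrite mulrC; move: b Ib; apply: IH.
  exact: is_ideal_transporter.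
by move=> w sw; have := Iw (t :: w); rewrite big_cons /= sw; apply.
Qed.

Lemma prod_mem_ideal_pow (R : comNzRingType) (T : Type) (g : T -> R) (w : seq T) :
  ideal_pow (fam_ideal g) (size w) (\prod_(t <- w) g t).
Proof.
elim: w => [//|t w IH]; rewrite big_cons.
by apply: ideal_mul_mem => //; apply: mem_ideal_gen; exists t.
Qed.

(** * Residue fields and separating functionals *)

Lemma residue_field (R : comNzRingType) (A : R -> Prop) :
  is_ideal A -> ~ A 1 ->
  exists (k : fieldType) (ev : {rmorphism R -> k}), forall a, A a -> ev a = 0.
Proof.
move=> iA A1.
pose Q (M : set R) := [/\ is_ideal M, ~ M 1 & forall a, A a -> M a].
have QA : Q A by split.
pose P : set (set R) := fun M => M = set0 \/ Q M.
have [F FP Ftot|M [PM Mmax]] := @Zorn_bigcup R P.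
  have [[X FX [x Xx]]|noX] := pselect (exists2 X, F X & exists x, X x); last first.
    left; apply/seteqP; split=> // x [X FX Xx]; case: noX; exists X => //.
    by exists x.
  right; have QF Y y : F Y -> Y y -> Q Y.
    by move=> FY Yy; case: (FP _ FY) => // Y0; rewrite Y0 in Yy.
  split.
  - split.
    + by exists X => //; have [iX _ _] := QF _ _ FX Xx; apply: ideal0.
    + move=> a b [Y FY Ya] [Z FZ Zb].
      have [iY _ _] := QF _ _ FY Ya; have [iZ _ _] := QF _ _ FZ Zb.
      have [YZ|ZY] := Ftot _ _ FY FZ; [exists Z|exists Y] => //; apply: idealD => //.
        exact: YZ.
      exact: ZY.
    + move=> r a [Y FY Ya]; exists Y => //; have [iY _ _] := QF _ _ FY Ya.
      exact: idealM.
  - by move=> [Y FY Y1]; have [_ + _] := QF _ _ FY Y1.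
  - by move=> a Aa; exists X => //; have [_ _] := QF _ _ FX Xx; apply.
have {PM}[iM M1 AM] : Q M.
  case: PM => // M0; case: (Mmax A); last by right.
  by rewrite M0; split=> // /(_ 0 (ideal0 iA)).
pose I : {pred R} := fun x => `[< M x >].
have IE x : (x \in I) = `[< M x >] by [].
have Iid : idealr_closed I.
  split; first by rewrite IE; apply/asboolP; apply: ideal0.
    by rewrite IE; apply/asboolP.
  move=> a u v; rewrite !IE => /asboolP Mu /asboolP Mv; apply/asboolP.
  by apply: idealD => //; apply: idealM.
pose iI : idealr R := HB.pack I (isIdealr.Build R I Iid).
pose Qt : comNzRingType := {ideal_quot iI}.
have piE0 a : (\pi_Qt%qT a == 0) = `[< M a >].
  by rewrite -IE -[0](rmorph0 (\pi_Qt%qT)) -(Quotient.idealrBE iI) subr0.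
have inv_ex (x : Qt) : exists y : Qt, (x != 0 -> y * x = 1) /\ (x = 0 -> y = 0).
  have [->|x0] := eqVneq x 0; first by exists 0; split=> // /negP[].
  rewrite -[x]reprK in x0 *; set a := repr x in x0 *.
  have /asboolP Ma : ~~ `[< M a >] by rewrite -piE0.
  (* This is [M + (a)]. By maximality it contains [1], and the [r] with [1 - r * a] in [M] is an
     inverse of [a] modulo [M]. *)
  pose M' : set R := fun z => exists r, M (z - r * a).
  have iM' : is_ideal M'.
    split; first by exists 0; rewrite mul0r subr0; apply: ideal0.
      move=> b c [r Mb] [s Mc]; exists (r + s).
      by rewrite mulrDl opprD addrACA; apply: idealD.
    by move=> r b [s Mb]; exists (r * s); rewrite -mulrA -mulrBr; apply: idealM.
  have MM' : forall z, M z -> M' z by move=> z Mz; exists 0; rewrite mul0r subr0.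
  have [[r Mr]|M'1] := pselect (M' 1).
    exists (\pi r)%qT; split; last by move=> /eqP e; rewrite e in x0.
    move=> _; apply/eqP; rewrite -subr_eq0 -rmorphM -(rmorph1 (\pi_Qt%qT)) -rmorphB piE0.
    by apply/asboolP; rewrite -opprB; apply: idealN.
  case: (Mmax M').
    split=> // M'M; apply: Ma; apply: M'M; exists 1.
    by rewrite mul1r subrr; apply: ideal0.
  by right; split=> // z /AM/MM'.
have [inv invP] := choice inv_ex.
have invl (x : Qt) : x != 0 -> inv x * x = 1 by case: (invP x).
have inv0 : inv 0 = 0 by case: (invP 0) => _; apply.
pose k : fieldType := HB.pack (Qt : Type) Qt
  (GRing.ComNzRing_isField.Build Qt invl inv0).
exists k, (\pi_Qt%qT : {rmorphism R -> Qt}) => a /AM Ma.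
by apply/eqP; rewrite piE0; apply/asboolP.
Qed.

(** This is the ideal [J + (d 0, ..., d (t - 1))]. *)
Fixpoint ideal_adjoin (R : comNzRingType) (J : R -> Prop) (d : nat -> R) (t : nat) :
    R -> Prop :=
  if t is t'.+1 then fun x => exists r, ideal_adjoin J d t' (x - r * d t') else J.

Lemma ideal_adjoin_is_ideal (R : comNzRingType) (J : R -> Prop) d t :
  is_ideal J -> is_ideal (ideal_adjoin J d t).
Proof.
move=> iJ; elim: t => //= t IH; split.
- by exists 0; rewrite mul0r subr0; apply: ideal0.
- move=> b c [r Mb] [s Mc]; exists (r + s).
  by rewrite mulrDl opprD addrACA; apply: idealD.
- by move=> r b [s Mb]; exists (r * s); rewrite -mulrA -mulrBr; apply: idealM.
Qed.

Lemma ideal_adjoin_mono (R : comNzRingType) (J : R -> Prop) d t t' x :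
  is_ideal J -> (t <= t')%N -> ideal_adjoin J d t x -> ideal_adjoin J d t' x.
Proof.
move=> iJ /subnK <-; elim: (t' - t)%N => // u IH Jx.
by exists 0; rewrite mul0r subr0; apply: IH.
Qed.

Lemma fam_ideal_coef (R : comNzRingType) (T : finType) (g : T -> R) z :
  fam_ideal g z -> exists c : T -> R, z = \sum_t c t * g t.
Proof.
move: z; apply: ideal_gen_sub => [|_ [t ->]].
  split.
  - by exists (fun=> 0); rewrite big1 // => t _; rewrite mul0r.
  - move=> _ _ [c ->] [c' ->]; exists (fun t => c t + c' t).
    by rewrite -big_split; apply: eq_bigr => t _; rewrite mulrDl.
  - move=> r _ [c ->]; exists (fun t => r * c t).
    by rewrite mulr_sumr; apply: eq_bigr => t _; rewrite mulrA.
exists (fun u => (u == t)%:R); rewrite (bigD1 t) //= eqxx mul1r big1 ?addr0 //.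
by move=> u /negPf ->; rewrite mul0r.
Qed.

Definition semilinear_on (R : comNzRingType) (k : fieldType) (J : R -> Prop)
    (ev : R -> k) (phi : R -> k) : Prop :=
  (forall a b, J a -> J b -> phi (a + b) = phi a + phi b) /\
  (forall r a, J a -> phi (r * a) = ev r * phi a).

Lemma semilinear_sum (R : comNzRingType) (k : fieldType) (J : R -> Prop)
    (ev : {rmorphism R -> k}) (phi : R -> k) (T : Type) (s : seq T) (P : pred T) (F : T -> R) :
  is_ideal J -> semilinear_on J ev phi -> (forall t, P t -> J (F t)) ->
  phi (\sum_(t <- s | P t) F t) = \sum_(t <- s | P t) phi (F t).
Proof.
move=> iJ [phiD phiM] JF.
have phi0 : phi 0 = 0.
  by rewrite -[in LHS](mul0r 0) phiM ?rmorph0 ?mul0r //; apply: ideal0.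
suff [] : J (\sum_(t <- s | P t) F t) /\
  phi (\sum_(t <- s | P t) F t) = \sum_(t <- s | P t) phi (F t) by [].
elim/big_rec2: _ => [|t y1 y2 /JF Jt [J2 <-]]; first by split=> //; apply: ideal0.
by split; [apply: idealD|rewrite phiD].
Qed.

(* Nakayama without localization: the functional is a quotient map of [J / J'] onto a
   residue field. *)
Lemma separating_functional (R : comNzRingType) (J' : R -> Prop) (N : nat) (d : nat -> R) :
  is_ideal J' -> (exists2 e, (e < N)%N & ~ J' (d e)) ->
  let J := fam_ideal (fun e : 'I_N => d e) in
  exists (k : fieldType) (ev : {rmorphism R -> k}) (phi : R -> k),
    [/\ semilinear_on J ev phi, forall z, J z -> J' z -> phi z = 0 &
        exists e : 'I_N, phi (d e) != 0].
Proof.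
move=> iJ' [e1 e1N Je1] J.
pose full t := `[< forall e, (e < N)%N -> ideal_adjoin J' d t (d e) >].
have fullN : full N.
  apply/asboolP => e eN; apply: (@ideal_adjoin_mono _ _ _ e.+1) => //.
  exists 1; rewrite mul1r subrr; apply: ideal0; exact: ideal_adjoin_is_ideal.
(* The least full index is [t.+1]. With [L] spanned by [J'] and the first [t] elements,
   [(J + L) / L] is nonzero and cyclic, generated by [d t], hence isomorphic to [R / (L : d t)];
   [phi] is the map onto a residue field of the latter. *)
case: (ex_minnP (ex_intro _ N fullN)) => -[|t] /asboolP ft tmin.
  by have := ft _ e1N => /Je1.
have tN : (t < N)%N by apply: tmin.
set L := ideal_adjoin J' d t in ft *.
have iL : is_ideal L by apply: ideal_adjoin_is_ideal.
have Lt : ~ L (d t).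
  move=> Lt; have : (t < t)%N; last by rewrite ltnn.
  apply: tmin; apply/asboolP => e eN; have [r Lr] := ft e eN.
  by rewrite -[d e](subrK (r * d t)); apply: idealD => //; apply: idealM.
have [|k [ev evL]] := @residue_field R _ (is_ideal_transporter (d t) iL).
  by rewrite mulr1.
have rex z : exists r, J z -> L (z - r * d t).
  have [Jz|nJz] := pselect (J z); last by exists 0.
  suff [r Lr] : ideal_adjoin J' d t.+1 z by exists r.
  move: z Jz; apply: ideal_gen_sub; first exact: ideal_adjoin_is_ideal.
  by move=> _ [e ->]; apply: ft.
have [r rP] := choice rex.
have evU z a : J z -> L (z - a * d t) -> ev (r z) = ev a.
  move=> /rP Lz La; apply/eqP; rewrite -subr_eq0 -rmorphB; apply/eqP/evL.
  rewrite (_ : d t * _ = (z - a * d t) - (z - r z * d t)); last by ring.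
  exact: idealB.
have iJ : is_ideal J by apply: ideal_gen_is_ideal.
have Jd e : (e < N)%N -> J (d e).
  by move=> eN; apply: mem_ideal_gen; exists (Ordinal eN).
exists k, ev, (fun z => ev (r z)); split.
- split=> [a b Ja Jb|a z Jz].
    rewrite -rmorphD; apply: evU; first exact: idealD.
    by rewrite mulrDl opprD addrACA; apply: idealD => //; apply: rP.
  rewrite -rmorphM; apply: evU; first exact: idealM.
  by rewrite -mulrA -mulrBr; apply: idealM => //; apply: rP.
- move=> z Jz J'z; rewrite (evU z 0) ?rmorph0 // mul0r subr0.
  exact: (@ideal_adjoin_mono _ _ _ 0).
- exists (Ordinal tN) => /=; rewrite (evU _ 1) ?rmorph1 ?oner_eq0 //; first exact: Jd.
  by rewrite mul1r subrr; apply: ideal0.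
Qed.

(** Indexing by tuples leaves finitely many coefficients, which can then form a square matrix. *)
Lemma ideal_mul_pow_coef (R : comNzRingType) (T : finType) (g : T -> R) (J : R -> Prop)
    (r : nat) z :
  is_ideal J -> ideal_mul J (ideal_pow (fam_ideal g) r) z ->
  exists l : r.-tuple T -> R,
    (forall t, J (l t)) /\ z = \sum_t l t * \prod_(p <- t) g p.
Proof.
move=> iJ; pose I z := exists l : r.-tuple T -> R,
    (forall t, J (l t)) /\ z = \sum_t l t * \prod_(p <- t) g p.
rewrite -/(I z).
have iI : is_ideal I.
  split.
  - exists (fun=> 0); split; first by move=> _; apply: ideal0.
    by rewrite big1 // => t _; rewrite mul0r.
  - move=> _ _ [c [Jc ->]] [c' [Jc' ->]]; exists (fun t => c t + c' t).
    split; first by move=> t; apply: idealD.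
    by rewrite -big_split; apply: eq_bigr => t _; rewrite mulrDl.
  - move=> a _ [c [Jc ->]]; exists (fun t => a * c t).
    split; first by move=> t; apply: idealM.
    by rewrite mulr_sumr; apply: eq_bigr => t _; rewrite mulrA.
move: z; apply: ideal_gen_sub => // _ [a [b [Ja Ib ->]]].
move: b Ib; apply: ideal_pow_sub; first exact: is_ideal_transporter.
move=> w /eqP sw; exists (fun t => if t == Tuple sw then a else 0); split.
  by move=> t; case: ifP => // _; apply: ideal0.
rewrite (bigD1 (Tuple sw)) //= eqxx [X in _ = _ + X]big1 ?addr0 //.
by move=> t /negPf ->; rewrite mul0r.
Qed.

(** Arcs through a point are built this way: constants go through [sec \o ev] and each variable to a
    chosen lift of its value, one polynomial layer at a time. *)
Lemma mpoly_lift (K : comNzRingType) (N : nat) (A B : comNzRingType)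
    (ev : {rmorphism mpoly K N -> A}) (pr : {rmorphism B -> A}) (sec : {rmorphism A -> B})
    (v : nat -> B) :
  cancel sec pr -> (forall j, (j < N)%N -> pr (v j) = ev (mvar K N j)) ->
  exists Psi : {rmorphism mpoly K N -> B},
    (forall f, pr (Psi f) = ev f) /\ (forall j, (j < N)%N -> Psi (mvar K N j) = v j).
Proof.
move=> secK; elim: N ev => [|N IH] ev prv.
  by exists (sec \o ev); split=> // f /=.
have [|Psi [prPsi Psiv]] := IH (ev \o (polyC : mpoly K N -> {poly mpoly K N})).
  move=> j jN; rewrite prv ?(ltn_trans jN) //=.
  by rewrite (ltn_eqF jN).
have cu : commr_rmorph Psi (v N) by move=> f; apply: mulrC.
exists (horner_morph cu : {rmorphism {poly mpoly K N} -> B}); split.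
  move=> f; rewrite /= /horner_morph; elim/poly_ind: f => [|f c IHf].
    by rewrite !rmorph0 horner0 !rmorph0.
  rewrite rmorphD rmorphM /= map_polyX map_polyC hornerMXaddC !rmorphD !rmorphM /= IHf.
  by rewrite prPsi prv //= eqxx.
move=> j; rewrite ltnS leq_eqVlt => /orP[/eqP->|jN] /=.
  by rewrite eqxx /horner_morph map_polyX hornerX.
by rewrite (ltn_eqF jN) /horner_morph map_polyC hornerC; apply: Psiv.
Qed.

(** * The diagonals generate a reduction *)

Definition young (n m : nat) (C : rel nat) : Prop :=
  (forall i j, C i j -> (i < n)%N && (j < m)%N) /\
  (forall i j i' j', (i' <= i)%N -> (j' <= j)%N -> C i j -> C i' j').

Definition cell_gen (R : comNzRingType) (n m : nat) (C : rel nat) (x y : nat -> R)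
  (p : 'I_n * 'I_m) : R := if C p.1 p.2 then x p.1 * y p.2 else 0.

(* The diagonal [j - i = e - n]; shifting by [n] keeps the index in [nat]. *)
Definition diag (R : comNzRingType) (n m : nat) (C : rel nat) (x y : nat -> R)
  (e : nat) : R :=
  \sum_(p : 'I_n * 'I_m | (p.1 + e == p.2 + n)%N) cell_gen C x y p.

Definition cells_ideal (R : comNzRingType) n m C (x y : nat -> R) : R -> Prop :=
  fam_ideal (@cell_gen R n m C x y).

Definition diags_ideal (R : comNzRingType) n m C (x y : nat -> R) : R -> Prop :=
  fam_ideal (fun e : 'I_(n + m) => diag n m C x y e).

Lemma not_uniq_perm (T : eqType) (w : seq T) :
  ~~ uniq w -> exists p w', perm_eq w [:: p, p & w'].
Proof.
elim: w => [//|a w IH] /=; rewrite negb_and negbK => /orP[aw|/IH[p [w' pw]]].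
  by exists a, (rem a w); rewrite perm_cons perm_to_rem.
exists p, (a :: w'); apply: (@perm_trans _ (a :: [:: p, p & w'])).
  by rewrite perm_cons.
by apply/permP => z /=; lia.
Qed.

(** The corners lie on the diagonals [e + d] and [e - d] with [d = |i - i'| > 0], and the squares
    add up to [2 * e^2 + 2 * d^2]. *)
Lemma sq_diag_lt (n i j i' j' e : nat) :
  (i < n)%N -> (i' < n)%N -> (i + e = j + n)%N -> (i' + e = j' + n)%N -> i <> i' ->
  (e ^ 2 + e ^ 2 < (j' + n - i) ^ 2 + (j + n - i') ^ 2)%N.
Proof.
move=> lti lti' E E' ne; rewrite -!mulnn.
have [lt|le] := ltnP i i'.
  have -> : (j' + n - i = e + (i' - i))%N by lia.
  have -> : (j + n - i' = e - (i' - i))%N by lia.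
  have : (0 < i' - i)%N by lia.
  have : (i' - i <= e)%N by lia.
  by nia.
have -> : (j' + n - i = e - (i - i'))%N by lia.
have -> : (j + n - i' = e + (i - i'))%N by lia.
have : (0 < i - i')%N by lia.
have : (i - i' <= e)%N by lia.
by nia.
Qed.

Lemma same_diag_leq (n i j i' j' e : nat) :
  (i + e = j + n)%N -> (i' + e = j' + n)%N -> (j <= j')%N = (i <= i')%N.
Proof. lia. Qed.

(** The larger cell [q] forces the other three corners into [C], so none of the four factors is a
    default zero. *)
Lemma cell_genM (R : comNzRingType) n m C (x y : nat -> R) (p q : 'I_n * 'I_m) :
  young n m C -> (p.1 <= q.1)%N -> (p.2 <= q.2)%N -> C q.1 q.2 ->
  cell_gen C x y q * cell_gen C x y p =
  cell_gen C x y (p.1, q.2) * cell_gen C x y (q.1, p.2).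
Proof.
move=> [_ Cle] l1 l2 Cq; rewrite /cell_gen /=.
rewrite Cq (Cle _ _ _ _ l1 (leqnn _) Cq) (Cle _ _ _ _ (leqnn _) l2 Cq).
rewrite (Cle _ _ _ _ l1 l2 Cq); ring.
Qed.

(* Modulo [J I^r], a squared cell is a combination of products of two cells at equal distance
   on either side of its diagonal; this raises the sum of squares of the diagonal indices. *)
Lemma word_in_reduction (R : comNzRingType) n m C (x y : nat -> R) (r : nat)
    (w : seq ('I_n * 'I_m)) :
  young n m C -> (n * m <= r)%N -> size w = r.+1 ->
  ideal_mul (diags_ideal n m C x y) (ideal_pow (cells_ideal n m C x y) r)
    (\prod_(p <- w) cell_gen C x y p).
Proof.
move=> yC nmr; set K0 := ideal_mul _ _.
have iK : is_ideal K0 by apply: ideal_gen_is_ideal.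
pose dg (p : 'I_n * 'I_m) := (p.2 + n - p.1)%N.
pose pot (u : seq ('I_n * 'I_m)) := (\sum_(p <- u) dg p ^ 2)%N.
have pot_le u : (pot u <= size u * (m + n) ^ 2)%N.
  rewrite /pot; elim: u => [|p u IH]; first by rewrite big_nil.
  rewrite big_cons /= mulSn leq_add // leq_sqr /dg.
  by have := ltn_ord p.2; lia.
have [k] := ubnP (r.+1 * (m + n) ^ 2 - pot w)%N.
elim: k w => // k IH w wk sw.
(* Pigeonhole: [r.+1] letters, at most [r] cells in the box. *)
have : ~~ uniq w.
  apply/negP => /card_uniqP uw; have := max_card (mem w).
  by rewrite uw card_prod !card_ord sw; lia.
case/not_uniq_perm => p [w' pw].
have sw' : size w' = r.-1.
  by have := perm_size pw; rewrite sw /=; case: (r) => //= r' [].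
have r0 : (0 < r)%N by have := perm_size pw; rewrite sw => -[->].
have potw : pot w = (dg p ^ 2 + (dg p ^ 2 + pot w'))%N.
  by rewrite /pot (perm_big _ pw) /= !big_cons.
rewrite (perm_big _ pw) /= !big_cons; set z := \prod_(_ <- w') _.
have pe : (p.1 + dg p == p.2 + n)%N by rewrite /dg subnKC // ltnW // ltn_addl.
have -> : cell_gen C x y p * (cell_gen C x y p * z) =
    diag n m C x y (dg p) * (cell_gen C x y p * z) -
    \sum_(q : 'I_n * 'I_m | (q.1 + dg p == q.2 + n)%N && (q != p))
       cell_gen C x y q * (cell_gen C x y p * z).
  by rewrite /diag (bigD1 p) //= mulrDl mulr_suml addrK.
apply: idealB => //.
  apply: ideal_mul_mem.
    have lt : (dg p < n + m)%N.
      by rewrite /dg (leq_ltn_trans (leq_subr _ _)) // addnC ltn_add2l.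
    by apply: mem_ideal_gen; exists (Ordinal lt).
  have := @prod_mem_ideal_pow R _ (cell_gen C x y) (p :: w').
  by rewrite big_cons (_ : size (p :: w') = r) //= sw' prednK.
apply: ideal_sum => // q /andP[/eqP qe qp].
have [Cq|nCq] := boolP (C q.1 q.2); last first.
  by rewrite {1}/cell_gen (negPf nCq) mul0r; apply: ideal0.
have [Cp|nCp] := boolP (C p.1 p.2); last first.
  by rewrite {1 2}/cell_gen (negPf nCp) mul0r mulr0; apply: ideal0.
have pq1 : nat_of_ord p.1 <> nat_of_ord q.1.
  move=> e1; move/negP: qp; apply; rewrite -pair_eqE /pair_eq /= -!val_eqE /= e1 eqxx /=.
  by move/eqP: pe; rewrite e1 qe => /addIn ->.
have -> : cell_gen C x y q * (cell_gen C x y p * z) =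
    \prod_(s <- [:: (p.1, q.2), (q.1, p.2) & w']) cell_gen C x y s.
  rewrite !big_cons -/z !mulrA; congr (_ * z).
  move/eqP: pe => pe; have [le|lt] := leqP p.1 q.1.
    by apply: cell_genM => //; rewrite (same_diag_leq pe qe).
  rewrite mulrC [RHS]mulrC; apply: cell_genM => //; first exact: ltnW.
  by rewrite (same_diag_leq qe pe) ltnW.
apply: IH; last by rewrite /= sw'; lia.
have := pot_le [:: (p.1, q.2), (q.1, p.2) & w'].
have -> : size [:: (p.1, q.2), (q.1, p.2) & w'] = r.+1 by rewrite /= sw'; lia.
have : (pot w < pot [:: (p.1, q.2), (q.1, p.2) & w'])%N.
  rewrite potw /pot !big_cons !addnA ltn_add2r /dg /=.
  by apply: sq_diag_lt; rewrite ?ltn_ord //; apply/eqP.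
by lia.
Qed.

Lemma diag_mem_cells_ideal (R : comNzRingType) n m C (x y : nat -> R) e :
  cells_ideal n m C x y (diag n m C x y e).
Proof.
have iI := ideal_gen_is_ideal (fun z => exists t, z = @cell_gen R n m C x y t).
by apply: ideal_sum => // p _; apply: mem_ideal_gen; exists p.
Qed.

Lemma diags_reduction (R : comNzRingType) n m C (x y : nat -> R) :
  young n m C -> is_reduction (diags_ideal n m C x y) (cells_ideal n m C x y).
Proof.
move=> yC.
have JI : ideal_sub (diags_ideal n m C x y) (cells_ideal n m C x y).
  apply: ideal_gen_sub; first exact: ideal_gen_is_ideal.
  by move=> _ [e ->]; apply: diag_mem_cells_ideal.
split; first exact: ideal_gen_is_ideal.
split=> //; exists (n * m)%N => z; split; last exact: ideal_mul_mono.
apply: ideal_pow_sub; first exact: ideal_gen_is_ideal.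
by move=> w sw; apply: word_in_reduction.
Qed.

(** * Local structure of the diagonal ideal *)

Lemma diagE (R : comNzRingType) n m C (x y : nat -> R) e :
  young n m C ->
  diag n m C x y e =
  \sum_(i < n) if (n <= i + e)%N && C i (i + e - n)%N then x i * y (i + e - n)%N else 0.
Proof.
move=> [Cb _]; rewrite /diag (eq_bigl (fun p : 'I_n * 'I_m => true && (p.1 + e == p.2 + n)%N)) //.
rewrite -(pair_big_dep xpredT (fun (i : 'I_n) (j : 'I_m) => (i + e == j + n)%N)
  (fun i j => cell_gen C x y (i, j))) /=.
apply: eq_bigr => i _; case: ifP => [/andP[le Cij]|nC].
  have /andP[_ lt] := Cb _ _ Cij.
  rewrite (bigD1 (Ordinal lt)) /=; last by rewrite subnK.
  rewrite /cell_gen /= Cij big1 ?addr0 // => j /andP[/eqP ej /negP[]].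
  by apply/eqP/val_inj; rewrite /= ej addnK.
rewrite big1 // => j /eqP ej; rewrite /cell_gen /=; case: ifP => // Cij.
by move: nC; rewrite ej leq_addl addnK Cij.
Qed.

Lemma young_tr n m C : young n m C -> young m n (fun j i => C i j).
Proof.
case=> Cb Cle; split=> [i j /Cb|i j i' j' l1 l2]; first by rewrite andbC.
exact: Cle.
Qed.

Lemma diag_tr (R : comNzRingType) n m C (x y : nat -> R) e e' :
  (e + e' = n + m)%N -> diag m n (fun j i => C i j) y x e' = diag n m C x y e.
Proof.
move=> ee'; rewrite /diag (reindex (fun p : 'I_n * 'I_m => (p.2, p.1))) /=; last first.
  by apply: onW_bij; exists (fun p => (p.2, p.1)) => -[].
apply: eq_big => [[i j]|[i j] _] /=; last first.
  by rewrite /cell_gen /= mulrC.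
by apply/eqP/eqP; lia.
Qed.

Lemma diags_ideal_tr (R : comNzRingType) n m C (x y : nat -> R) :
  ideal_sub (diags_ideal m n (fun j i => C i j) y x) (diags_ideal n m C x y).
Proof.
apply: ideal_gen_sub; first exact: ideal_gen_is_ideal.
(* Transposition sends index [e] to [n + m - e], out of range only for [e = 0], where the diagonal
   is empty. *)
move=> _ [e ->]; have [e0|e0] := posnP e.
  rewrite /diag big1; first by apply: ideal0; apply: ideal_gen_is_ideal.
  move=> p /eqP; rewrite e0 addn0 => pe; have := ltn_ord p.1.
  by rewrite pe -[X in (_ < X)%N]add0n ltn_add2r ltn0.
have lt : (n + m - e < n + m)%N by have := ltn_ord e; lia.
apply: mem_ideal_gen; exists (Ordinal lt); apply: diag_tr => /=.
by have := ltn_ord e; lia.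
Qed.

Lemma column_height n m C b :
  young n m C -> exists2 p, (p <= n)%N & forall i, C i b = (i < p)%N.
Proof.
move=> [Cb Cle].
have nCn : ~~ C n b by apply/negP => /Cb; rewrite ltnn.
case: (ex_minnP (ex_intro (fun i => ~~ C i b) n nCn)) => p nCp pmin.
exists p; first exact: pmin.
move=> i; have [lt|le] := ltnP i p.
  by apply: contraTT lt => /pmin; rewrite leqNgt.
by apply: contraNF nCp; apply: Cle.
Qed.

(* Near a point where [y_b] is the first nonvanishing column variable, the diagonals through the
   cells of column [b] are linear in the [x_i] of that column, with a matrix that is triangular
   and invertible at the point. *)
Lemma row_saturation (R : comNzRingType) (k : fieldType) (ev : {rmorphism R -> k})
    n m C (x y : nat -> R) b :
  young n m C -> (b < m)%N -> (forall j, (j < b)%N -> ev (y j) = 0) -> ev (y b) != 0 ->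
  exists2 r, ev r != 0 & forall i, C i b -> diags_ideal n m C x y (r * x i).
Proof.
move=> yC bm yb0 yb; have [p pn Cp] := column_height b yC.
have [_ Cle] := yC.
(* Row [i] of [M] holds the coefficients of the diagonal through [(i, b)] in the variables [x i'].
   Rows [i' >= p] of the tableau do not meet that diagonal: such a cell would lie right of column
   [b] and force [(i', b)] into [C]. *)
pose M : 'M[R]_p := \matrix_(i, i')
  (if (i <= i' + b)%N && C i' (i' + b - i)%N then y (i' + b - i)%N else 0).
have MD (i : 'I_p) : diag n m C x y (b + n - i) = \sum_(i' < p) M i i' * x i'.
  under [RHS]eq_bigr do rewrite mxE.
  rewrite diagE // (big_ord_widen n (fun i' =>
    (if (i <= i' + b)%N && C i' (i' + b - i)%N then y (i' + b - i)%N else 0) * x i') pn).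
  rewrite (bigID (fun i' : 'I_n => (i' < p)%N)) /= [X in _ + X]big1 ?addr0; last first.
    move=> i'; rewrite -leqNgt => pi'; case: ifP => // /andP[_ Ci'].
    have : C i' b by apply: Cle Ci' => //; have := ltn_ord i; lia.
    by rewrite Cp ltnNge pi'.
  apply: eq_bigr => i' i'p; have ilt := ltn_ord i.
  have -> : (i' + (b + n - i) - n = i' + b - i)%N by lia.
  have -> : (n <= i' + (b + n - i))%N = (i <= i' + b)%N by apply/idP/idP; lia.
  by case: ifP => _; rewrite ?mul0r // mulrC.
exists (\det M).
  rewrite -det_map_mx -det_tr det_trig.
    apply/prodf_neq0 => i _; rewrite !mxE leq_addr addKn.
    by rewrite Cp ltn_ord.
  apply/is_trig_mxP => i j lt; rewrite !mxE; case: ifP => [/andP[le _]|]; rewrite ?rmorph0 //.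
  by apply: yb0; lia.
have iJ := ideal_gen_is_ideal (fun z => exists t : 'I_(n + m), z = diag n m C x y t).
move=> i0; rewrite Cp => i0p.
(* Cramer's rule: the adjugate is applied to the system. *)
have -> : \det M * x i0 =
    \sum_(i < p) (\adj M) (Ordinal i0p) i * diag n m C x y (b + n - i).
  transitivity ((\adj M *m M *m (\col_i x i)) (Ordinal i0p) 0).
    by rewrite mul_adj_mx mul_scalar_mx !mxE.
  rewrite -mulmxA mxE; apply: eq_bigr => i _; congr (_ * _).
  by rewrite mxE MD; apply: eq_bigr => i' _; rewrite [in LHS]mxE [in LHS]mxE [in RHS]mxE.
apply: ideal_sum => // i _; apply: idealM => //.
have lt : (b + n - i < n + m)%N by lia.
by apply: mem_ideal_gen; exists (Ordinal lt).
Qed.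

(** * Newton iteration *)

(** Sliding along the diagonal towards the origin stays in [C] and stops at row [p] or column [q],
    whichever comes first. *)
Lemma top_cell n m C p q e i j :
  young n m C -> C i j -> (p <= i)%N -> (q <= j)%N -> (i + e = j + n)%N ->
  exists i0 j0, [/\ C i0 j0, (i0 + e = j0 + n)%N &
    (i0 = p /\ (q <= j0)%N) \/ ((p < i0)%N /\ j0 = q)].
Proof.
move=> [_ Cle] Cij pi qj ie; have [le|lt] := leqP (q + n) (p + e).
  exists p, (p + e - n)%N; split; last by left; split=> //; lia.
    by apply: Cle Cij; lia.
  by lia.
exists (q + n - e)%N, q; split; last by right; split=> //; lia.
  by apply: Cle Cij; lia.
by lia.
Qed.

(* Newton iteration at the point [x_p = y_q = 1], all other variables [0], where the differential
   of the diagonals is the identity on the first row and column. *)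
Lemma solve_diags (k : fieldType) n m C p q (T : nat -> k) M :
  young n m C ->
  exists (X Y : nat -> {poly k}) (c : nat -> k), forall e i j,
    C i j -> (p <= i)%N -> (q <= j)%N -> (i + e = j + n)%N ->
    'X^M %| diag n m (fun i j => [&& C i j, (p <= i)%N & (q <= j)%N]) X Y e
            - ((c e)%:P + (T e)%:P * 'X).
Proof.
move=> yC; have [Cb Cle] := yC.
pose C' i j := [&& C i j, (p <= i)%N & (q <= j)%N]; rewrite -/C'.
have [Cpq|nCpq] := boolP (C p q); last first.
  exists (fun=> 0), (fun=> 0), (fun=> 0) => e i j Cij pi qj _.
  by case/negP: nCpq; apply: Cle Cij.
(* At the starting point only the cell [(p, q)] is nonzero, so the constant term is [1] on its
   diagonal and [0] on the others. *)
pose c e : k := (p + e == q + n)%N%:R.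
pose tg e : {poly k} := (c e)%:P + (T e)%:P * 'X.
suff [X [Y XY]] : exists X Y : nat -> {poly k},
    [/\ X p = 1, forall i, (p < i)%N -> C i q -> 'X %| X i,
        'X %| Y q - 1, forall j, (q < j)%N -> C p j -> 'X %| Y j &
        forall e i j, C i j -> (p <= i)%N -> (q <= j)%N -> (i + e = j + n)%N ->
          'X^(M.+1) %| diag n m C' X Y e - tg e].
  exists X, Y, c => e i j Cij pi qj ie; have [_ _ _ _ H] := XY.
  by apply: dvdp_trans (H e i j Cij pi qj ie); apply: dvdp_exp2l.
elim: M => [|M [X [Y [Xp Xi Yq Yj D]]]].
  exists (fun i => (i == p)%:R), (fun j => (j == q)%:R); split.
  - by rewrite eqxx.
  - by move=> i lt _; rewrite gtn_eqF // dvdp0.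
  - by rewrite eqxx subrr dvdp0.
  - by move=> j lt _; rewrite gtn_eqF // dvdp0.
  - move=> e i j Cij pi qj ie; rewrite expr1.
    have /andP[pn qm] := Cb _ _ Cpq.
    have -> : diag n m C' (fun i => (i == p)%:R) (fun j => (j == q)%:R) e = (c e)%:P.
      rewrite /diag /c.
      have z0 (P : 'I_n * 'I_m) : P != (Ordinal pn, Ordinal qm) ->
          cell_gen C' (fun i => (i == p)%:R) (fun j => (j == q)%:R) P = 0 :> {poly k}.
        case: P => a b; rewrite -pair_eqE /pair_eq /= -!val_eqE /= /cell_gen /=.
        by case: ifP => // _; case: eqP; case: eqP => //; rewrite ?mul0r ?mulr0.
      have [pe|npe] := boolP (p + e == q + n)%N.
        rewrite (bigD1 (Ordinal pn, Ordinal qm)) //= big1 => [|P /andP[_ /z0 //]].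
        by rewrite addr0 /cell_gen /= /C' Cpq !leqnn !eqxx mul1r.
      rewrite big1 // => P Pe; apply: z0; apply: contraNneq npe => PE.
      by move: Pe; rewrite PE.
    by rewrite /tg opprD addNKr dvdpNr dvdp_mulIr.
pose E e := diag n m C' X Y e - tg e.
(* The error of each diagonal is charged to one variable of its top cell: [Y j] if that cell is
   [(p, j)], and [X i] if it is [(i, q)] with [p < i]. [X p] stays equal to [1]. *)
pose X1 i := if i == p then X i else X i - E (q + n - i)%N.
pose Y1 j := Y j - E (j + n - p)%N.
have X1p : X1 p = 1 by rewrite /X1 eqxx.
have X1i i : (p < i)%N -> X1 i = X i - E (q + n - i)%N by move=> lt; rewrite /X1 gtn_eqF.
have Ei i : (p < i)%N -> C i q -> 'X^(M.+1) %| E (q + n - i)%N.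
  move=> pi Ciq; apply: (D _ _ _ Ciq) => //; first exact: ltnW.
  by have /andP[] := Cb _ _ Ciq; lia.
have Ej j : (q <= j)%N -> C p j -> 'X^(M.+1) %| E (j + n - p)%N.
  move=> qj Cpj; apply: (D _ _ _ Cpj) => //.
  by have /andP[] := Cb _ _ Cpj; lia.
have dX (f : {poly k}) : 'X^(M.+1) %| f -> 'X %| f.
  by apply: dvdp_trans; rewrite exprS dvdp_mulIl.
have dMl (f g : {poly k}) : 'X^(M.+1) %| f -> 'X %| g -> 'X^(M.+2) %| f * g.
  by move=> ? ?; rewrite exprSr dvdp_mul.
exists X1, Y1; split=> //.
- by move=> i pi Ciq; rewrite X1i // dvdp_sub ?Xi // dX // Ei.
- by rewrite /Y1 addrAC dvdp_sub // dX // Ej.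
- by move=> j qj Cpj; rewrite dvdp_sub ?Yj // dX // Ej // ltnW.
move=> e i j Cij pi qj ie.
have [i0 [j0 [C0 e0 H0]]] := top_cell yC Cij pi qj ie.
have /andP[i0n j0m] := Cb _ _ C0.
pose P0 : 'I_n * 'I_m := (Ordinal i0n, Ordinal j0m).
have dE : 'X^(M.+1) %| E e by apply: D Cij _ _ _.
rewrite -[tg e](subKr (diag n m C' X Y e)) -/(E e) opprB addrA -addrAC.
rewrite /diag -sumrB (bigD1 P0) /=; last by rewrite e0.
rewrite addrAC; apply: dvdp_add.
  have C'0 : C' i0 j0 by rewrite /C' C0; case: H0 => [[-> ->]|[/ltnW -> ->]]; rewrite leqnn.
  rewrite /cell_gen /= C'0; case: H0 => [[i0p qj0]|[pi0 j0q]].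
    rewrite i0p X1p Xp /Y1 !mul1r (_ : j0 + n - p = e)%N; last by lia.
    by rewrite (_ : _ + _ = 0) ?dvdp0 //; ring.
  rewrite j0q in C0 e0 *.
  rewrite X1i // /Y1 (_ : q + n - i0 = e)%N; last by lia.
  set Eq := E (q + n - p)%N; have dEq : 'X^(M.+1) %| Eq by apply: Ej.
  have -> : (X i0 - E e) * (Y q - Eq) - X i0 * Y q + E e =
      - (E e * (Y q - 1)) - Eq * (X i0 - E e) by ring.
  by rewrite dvdp_sub ?dvdpNr ?dMl // dvdp_sub ?Xi // dX.
(* Any other cell of [C'] on the diagonal lies strictly beyond row [p] and column [q]. Both its
   variables are divisible by ['X], so corrections of order [M.+1] change it only at order
   [M.+2]. *)
elim/big_ind: _ => [|f g|[a b] /andP[/eqP /= ab abP]]; [exact: dvdp0|exact: dvdp_add|].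
rewrite /cell_gen /=; case: ifP => [/and3P[Cab pa qb]|_]; last by rewrite subrr dvdp0.
have ane : nat_of_ord a <> i0.
  move=> ae; case/negP: abP; rewrite -pair_eqE /pair_eq /= -!val_eqE /= ae eqxx /=.
  by apply/eqP; move: ab e0; rewrite ae => -> /addIn.
have {}pa : (p < a)%N by case: H0 => [[? ?]|[? ?]]; lia.
have {}qb : (q < b)%N by case: H0 => [[? ?]|[? ?]]; lia.
have Caq : C a q by apply: Cle Cab => //; exact: ltnW.
have Cpb : C p b by apply: Cle Cab => //; exact: ltnW.
rewrite X1i // /Y1; set Ea := E (q + n - a)%N; set Eb := E (b + n - p)%N.
have dEa : 'X^(M.+1) %| Ea by apply: Ei.
have dEb : 'X^(M.+1) %| Eb by apply: Ej => //; exact: ltnW.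
have -> : (X a - Ea) * (Y b - Eb) - X a * Y b =
    - (Ea * (Y b - Eb)) - Eb * X a by ring.
rewrite dvdp_sub ?dvdpNr ?dMl ?Xi // dvdp_sub ?Yj //; exact: dX.
Qed.

(** * Arcs and minimality *)

Lemma mup0_exp (k : fieldType) (f : {poly k}) r : f != 0 -> (mup 0 (f ^+ r) = r * mup 0 f)%N.
Proof.
move=> f0; elim: r => [|r IH]; first by rewrite expr0 mupNroot // rootC oner_eq0.
by rewrite exprS mupM ?expf_neq0 // IH mulSn.
Qed.

(* Along the arc, [z0] and the elements of [J'] have leading coefficients [kap + phi z0 * s] and
   constants respectively, modulo [s^M]. So [z0 * I^r <= J' * I^r] makes the leading coefficients
   of the generators of [I^r] an eigenvector with eigenvalue [s] of a constant matrix. *)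
Lemma arc_contradiction (R : comNzRingType) (k : fieldType) (T : finType) (g : T -> R)
    (J J' : R -> Prop) (phi : R -> k) (z0 : R) (r : nat) :
  is_ideal J' -> ideal_sub J' J -> J z0 -> phi z0 != 0 -> (forall z, J' z -> phi z = 0) ->
  fam_ideal g z0 ->
  ideal_sub (ideal_pow (fam_ideal g) r.+1) (ideal_mul J' (ideal_pow (fam_ideal g) r)) ->
  (forall M, exists (Psi : {rmorphism R -> {poly {poly k}}}) (G : T -> {poly {poly k}}),
    (forall t, Psi (g t) = 'X^2 * G t) /\
    (forall z, J z -> exists (h : {poly {poly k}}) (kap : k),
       Psi z = 'X^2 * h /\ 'X^M %| h.[0] - (kap%:P + (phi z)%:P * 'X))) ->
  False.
Proof.
move=> iJ' J'J Jz0 phi0 phiJ' Iz0 red arc.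
pose tp : finType := r.-tuple T.
(* The exponent must exceed [N + r]: the order at [0] is at most [N] for [char_poly A] and at most
   [r] for the [r]-th power of a suitable [(G t0).[0]]. It must also be at least [2], to keep the
   coefficient [tau] of ['X] visible. *)
set N := #|tp|; have [Psi [G [PsiG PsiJ]]] := arc (N + r + 2)%N.
set M := (N + r + 2)%N in PsiJ.
have lex (t : tp) : exists l : tp -> R, (forall t', J' (l t')) /\
    z0 * \prod_(p <- t) g p = \sum_t' l t' * \prod_(p <- t') g p.
  apply: ideal_mul_pow_coef => //; apply: red; apply: ideal_mul_mem => //.
  by have := prod_mem_ideal_pow g t; rewrite size_tuple.
have [l lP] := choice lex.
have hex (tt : tp * tp) : exists hk : {poly {poly k}} * k,
    Psi (l tt.1 tt.2) = 'X^2 * hk.1 /\ 'X^M %| hk.1.[0] - hk.2%:P.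
  have J'l := (lP tt.1).1 tt.2.
  have [h [kap [E D]]] := PsiJ _ (J'J _ J'l); exists (h, kap); split=> //=.
  by move: D; rewrite phiJ' // polyC0 mul0r addr0.
have [hk hkP] := choice hex.
have [h0 [kap0 [E0 D0]]] := PsiJ _ Jz0.
set tau := phi z0 in phi0 D0.
pose F (t : tp) : {poly k} := \prod_(p <- t) (G p).[0].
have X0 n : 'X^n != 0 :> {poly {poly k}} by rewrite monic_neq0 ?monicXn.
have PsiP (t : tp) : Psi (\prod_(p <- t) g p) = 'X^(2 * r) * \prod_(p <- t) G p.
  have -> : (2 * r = 2 * size t)%N by rewrite size_tuple.
  elim: (tval t) => [|p s IH].
    by rewrite !big_nil rmorph1 mulr1.
  by rewrite !big_cons rmorphM IH PsiG /= mulnS exprD mulrACA.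
have FE (t : tp) : h0.[0] * F t = \sum_t' (hk (t, t')).1.[0] * F t'.
  have F0 (s : tp) : F s = (\prod_(p <- s) G p).[0] by rewrite horner_prod.
  rewrite F0 -hornerM; under [RHS]eq_bigr do rewrite F0 -hornerM.
  rewrite -horner_sum; congr (_.[_]); apply: (mulfI (X0 (2 + 2 * r)%N)).
  have := congr1 Psi (lP t).2; rewrite rmorphM rmorph_sum E0 PsiP => e.
  rewrite exprD mulrACA e mulr_sumr; apply: eq_bigr => t' _.
  by rewrite rmorphM PsiP (hkP (t, t')).1 mulrACA.
pose en (i : 'I_N) : tp := enum_val i.
(* The shift by [kap0] and the factor [tau^-1] turn the eigenvalue [kap0 + tau * 'X] into ['X], so
   [char_poly_mx A] kills the vector [F] modulo ['X^M]. *)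
pose A : 'M[k]_N := \matrix_(i, j)
  (tau^-1 * ((hk (en i, en j)).2 - kap0 *+ (i == j))).
have dvdA i : 'X^M %| \sum_j char_poly_mx A i j * F (en j).
  have -> : \sum_j char_poly_mx A i j * F (en j) =
      tau^-1%:P * (\sum_j ((hk (en i, en j)).1.[0] -
                           (hk (en i, en j)).2%:P) * F (en j)
                   - (h0.[0] - (kap0%:P + tau%:P * 'X)) * F (en i)).
    have FE' : h0.[0] * F (en i) =
        \sum_j (hk (en i, en j)).1.[0] * F (en j).
      by rewrite FE (reindex en) //=; apply: onW_bij; apply: enum_val_bij.
    have tauV : tau^-1%:P * tau%:P = 1 :> {poly k} by rewrite -polyCM mulVf.
    under eq_bigr do rewrite !mxE.
    have dS (f : {poly k}) : \sum_j f *+ (i == j) * F (en j) = f * F (en i).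
      rewrite (bigD1 i) //= eqxx mulr1n big1 ?addr0 // => j.
      by rewrite eq_sym => /negPf ->; rewrite mulr0n mul0r.
    under eq_bigr do rewrite mulrBl.
    rewrite sumrB dS; under [X in _ = _ * (X - _)]eq_bigr do rewrite mulrBl.
    rewrite sumrB -FE'.
    have -> : \sum_j (tau^-1 * ((hk (en i, en j)).2 - kap0 *+ (i == j)))%:P *
          F (en j) =
        tau^-1%:P * (\sum_j (hk (en i, en j)).2%:P * F (en j) -
                     kap0%:P * F (en i)).
      rewrite -(dS kap0%:P) -sumrB mulr_sumr; apply: eq_bigr => j _.
      by rewrite polyCM polyCB polyCMn -mulrA mulrBl.
    rewrite -[X in X - _ = _]mul1r -tauV; ring.
  rewrite dvdp_mull // dvdp_sub ?dvdp_mulr //.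
  elim/big_ind: _ => [|f1 f2|j _]; [exact: dvdp0|exact: dvdp_add|].
  by rewrite dvdp_mulr // (hkP (_, _)).2.
(* The adjugate turns the matrix [char_poly_mx A] into the scalar [char_poly A]. *)
have dvdF t : 'X^M %| char_poly A * F t.
  rewrite -[t]enum_rankK -/(en _); set i := enum_rank t.
  have -> : char_poly A * F (en i) =
      \sum_j (\adj (char_poly_mx A)) i j * \sum_j' char_poly_mx A j j' * F (en j').
    transitivity ((\adj (char_poly_mx A) *m char_poly_mx A *m (\col_j F (en j))) i 0).
      by rewrite mul_adj_mx mul_scalar_mx !mxE.
    rewrite -mulmxA mxE; apply: eq_bigr => j _; congr (_ * _).
    by rewrite mxE; apply: eq_bigr => j' _; rewrite [in X in _ * X]mxE.
  elim/big_ind: _ => [|f1 f2|j _]; [exact: dvdp0|exact: dvdp_add|].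
  exact: dvdp_mull.
(* Otherwise [h0.[0]], a combination of the [(G t).[0]], would be divisible by ['X^2], although its
   coefficient of ['X] is [tau]. *)
have [t0 Gt0] : exists t0, ~~ ('X^2 %| (G t0).[0]).
  apply/not_existsP => nG.
  have [c z0E] := fam_ideal_coef Iz0.
  have h0E : h0 = \sum_t Psi (c t) * G t.
    apply: (mulfI (X0 2)); rewrite -E0 z0E rmorph_sum mulr_sumr.
    by apply: eq_bigr => t _; rewrite rmorphM PsiG mulrCA.
  have : 'X^2 %| h0.[0].
    rewrite h0E horner_sum; elim/big_ind: _ => [|f1 f2|t _]; [exact: dvdp0|exact: dvdp_add|].
    by rewrite hornerM dvdp_mull //; apply: contraT => /nG.
  rewrite -[h0.[0]](subrK (kap0%:P + tau%:P * 'X)) dvdp_addr; last first.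
    by apply: dvdp_trans D0; apply: dvdp_exp2l; rewrite leq_addl.
  case/dvdpP => q /(congr1 (fun f : {poly k} => f`_1)).
  rewrite coefD coefC coefCM coefX coefMXn /= add0r mulr1 => tau0.
  by rewrite tau0 eqxx in phi0.
have G0 : (G t0).[0] != 0 by apply: contraNneq Gt0 => ->; apply: dvdp0.
have := dvdF (nseq_tuple r t0).
have -> : F (nseq_tuple r t0) = (G t0).[0] ^+ r.
  rewrite /F /=; elim: (r) => [|s IH]; first by rewrite big_nil expr0.
  by rewrite /= big_cons IH exprS.
have chi0 : char_poly A != 0 by rewrite monic_neq0 ?char_poly_monic.
rewrite -['X]subr0 -polyC0 -mup_geq ?mulf_neq0 ?expf_neq0 // mupM ?expf_neq0 //.
rewrite mup0_exp //.
have : (mup 0 (G t0).[0] <= 1)%N by rewrite mup_leq // polyC0 subr0.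
have : (mup 0 (char_poly A) <= N)%N.
  rewrite mup_leq // polyC0 subr0; apply/negP => /(dvdp_leq chi0).
  by rewrite size_polyXn size_char_poly ltnn.
move: (mup _ _) (mup _ _) => a b; rewrite /M; nia.
Qed.

(** Here [p] is the height of the first column whose variable is nonzero at the point, or [0] if
    there is none; [u i] is the value that [phi] takes on [x i] once [r] is inverted. *)
Lemma row_linear_part (R : comNzRingType) (k : fieldType) (ev : {rmorphism R -> k})
    n m C (x y : nat -> R) (J : R -> Prop) (phi : R -> k) :
  young n m C -> ideal_sub (diags_ideal n m C x y) J ->
  exists (p : nat) (u : nat -> k) (r : R),
    [/\ ev r != 0,
        forall i, (i < p)%N -> J (r * x i) /\ phi (r * x i) = ev r * u i,
        forall i j, C i j -> ev (y j) != 0 -> (i < p)%N &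
        forall i, (i < p)%N -> exists2 j, C i j & ev (y j) != 0].
Proof.
move=> yC DJ; have [Cb Cle] := yC.
have [exb|nexb] := pselect (exists b, (b < m)%N && (ev (y b) != 0)); last first.
  exists 0%N, (fun=> 0), 1; split=> //; first by rewrite rmorph1 oner_eq0.
  move=> i j Cij yj; case: nexb; exists j; rewrite yj andbT.
  by have /andP[] := Cb _ _ Cij.
case: (ex_minnP exb) => b /andP[bm yb] bmin.
have yb0 j : (j < b)%N -> ev (y j) = 0.
  move=> jb; apply: contraTeq (jb) => yj; rewrite -leqNgt; apply: bmin.
  by rewrite yj (ltn_trans jb bm).
have [r r0 rJ] := row_saturation x yC bm yb0 yb.
have [p _ Cp] := column_height b yC.
exists p, (fun i => phi (r * x i) / ev r), r; split=> //.
- by move=> i; rewrite -Cp => /rJ/DJ Ji; split=> //; rewrite mulrCA divff // mulr1.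
- move=> i j Cij yj; rewrite -Cp; apply: Cle (Cij) => //; apply: bmin.
  by rewrite yj andbT; have /andP[] := Cb _ _ Cij.
- by move=> i; rewrite -Cp; exists b.
Qed.

(** After scaling by [r1 * r2] every cell of the diagonal lies in [J] on its own, so semilinearity
    evaluates [phi] cell by cell. A cell in both ranges contributes zero, as both of its variables
    vanish at the point. *)
Lemma diag_functional (R : comNzRingType) (k : fieldType) (ev : {rmorphism R -> k})
    n m C (x y : nat -> R) (J : R -> Prop) (phi : R -> k) p q (u v : nat -> k) (r1 r2 : R) e :
  is_ideal J -> semilinear_on J ev phi -> J (diag n m C x y e) ->
  ev r1 != 0 -> ev r2 != 0 ->
  (forall i, (i < p)%N -> J (r1 * x i) /\ phi (r1 * x i) = ev r1 * u i) ->
  (forall j, (j < q)%N -> J (r2 * y j) /\ phi (r2 * y j) = ev r2 * v j) ->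
  (forall i, (i < p)%N -> ev (x i) = 0) -> (forall j, (j < q)%N -> ev (y j) = 0) ->
  (forall i j, C i j -> (i + e = j + n)%N -> (i < p)%N || (j < q)%N) ->
  phi (diag n m C x y e) =
  \sum_(P : 'I_n * 'I_m | (P.1 + e == P.2 + n)%N)
    if C P.1 P.2 then (if (P.1 < p)%N then u P.1 * ev (y P.2) else 0) +
                      (if (P.2 < q)%N then ev (x P.1) * v P.2 else 0) else 0.
Proof.
move=> iJ semi JD r10 r20 Jx Jy x0 y0 cov; have [_ phiM] := semi.
have r12 : ev (r1 * r2) != 0 by rewrite rmorphM mulf_neq0.
apply: (mulfI r12); rewrite -phiM // /diag mulr_sumr mulr_sumr.
have cellP (P : 'I_n * 'I_m) : (P.1 + e == P.2 + n)%N -> C P.1 P.2 ->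
    J (r1 * r2 * (x P.1 * y P.2)) /\
    phi (r1 * r2 * (x P.1 * y P.2)) =
    ev (r1 * r2) * ((if (P.1 < p)%N then u P.1 * ev (y P.2) else 0) +
                    (if (P.2 < q)%N then ev (x P.1) * v P.2 else 0)).
  move=> /eqP Pe CP; have [Pp|Pp] := ltnP P.1 p.
    have [Jxi phix] := Jx _ Pp.
    have -> : r1 * r2 * (x P.1 * y P.2) = (r2 * y P.2) * (r1 * x P.1) by ring.
    split; first exact: idealM.
    rewrite phiM // phix x0 // !rmorphM mul0r if_same addr0; ring.
  have Pq : (P.2 < q)%N by have := cov _ _ CP Pe; rewrite ltnNge Pp.
  have [Jyj phiy] := Jy _ Pq.
  have -> : r1 * r2 * (x P.1 * y P.2) = (r1 * x P.1) * (r2 * y P.2) by ring.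
  split; first exact: idealM.
  rewrite Pq phiM // phiy !rmorphM add0r; ring.
have J0 : J 0 by apply: ideal0.
have phi0 : phi 0 = 0 by rewrite -[in LHS](mul0r 0) phiM // rmorph0 mul0r.
rewrite (semilinear_sum _ iJ semi) => [|P Pe]; last first.
  by rewrite /cell_gen; case: ifP => [/(cellP _ Pe)[]|] //; rewrite mulr0.
apply: eq_bigr => P Pe; rewrite /cell_gen.
by case: ifP => [/(cellP _ Pe)[]|_] //; rewrite !mulr0.
Qed.

Lemma ferrers_arc (K : fieldType) n m C (k : fieldType)
    (ev : {rmorphism mpoly K (n + m) -> k}) (phi : mpoly K (n + m) -> k) M :
  let x i := mvar K (n + m) i in let y j := mvar K (n + m) (n + j) in
  let J := diags_ideal n m C x y in
  young n m C -> semilinear_on J ev phi ->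
  (forall i j, C i j -> ev (x i) = 0 \/ ev (y j) = 0) ->
  exists (Psi : {rmorphism mpoly K (n + m) -> {poly {poly k}}})
         (G : 'I_n * 'I_m -> {poly {poly k}}),
    (forall P, Psi (cell_gen C x y P) = 'X^2 * G P) /\
    (forall z, J z -> exists (h : {poly {poly k}}) (kap : k),
       Psi z = 'X^2 * h /\ 'X^M %| h.[0] - (kap%:P + (phi z)%:P * 'X)).
Proof.
move=> x y J yC semi nocell; have [Cb _] := yC; have [phiD phiM] := semi.
have iJ : is_ideal J by apply: ideal_gen_is_ideal.
have [p [u [r1 [r10 Jx xp px]]]] :=
  row_linear_part ev phi yC (fun z (Jz : diags_ideal n m C x y z) => Jz : J z).
have [q [v [r2 [r20 Jy yq qy]]]] :=
  row_linear_part ev phi (young_tr yC) (@diags_ideal_tr _ n m C x y).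
have x0 i : (i < p)%N -> ev (x i) = 0.
  by move=> /px[j Cij yj]; case: (nocell _ _ Cij) => // y0; rewrite y0 eqxx in yj.
have y0 j : (j < q)%N -> ev (y j) = 0.
  by move=> /qy[i Cij xi]; case: (nocell _ _ Cij) => // x0'; rewrite x0' eqxx in xi.
(* Cells in the first [p] rows or [q] columns contribute [lin P * s] to the [t^2]-coefficient; the
   Newton iteration on the remaining tableau supplies the difference to [phi]. *)
pose lin (P : 'I_n * 'I_m) : k := if C P.1 P.2 then
  (if (P.1 < p)%N then u P.1 * ev (y P.2) else 0) +
  (if (P.2 < q)%N then ev (x P.1) * v P.2 else 0) else 0.
pose linD e := \sum_(P : 'I_n * 'I_m | (P.1 + e == P.2 + n)%N) lin P.
have [X0 [Y0 [c XYP]]] :=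
  solve_diags p q (fun e => phi (diag n m C x y e) - linD e) M yC.
pose X i := if (i < p)%N then (u i)%:P * 'X else X0 i.
pose Y j := if (j < q)%N then (v j)%:P * 'X else Y0 j.
(* The first [p] row variables and [q] column variables vanish at the point and move at order [t^2],
   the others at order [t]. A cell avoiding both ranges has both variables zero at the point, so
   every cell acquires the factor [t^2]. *)
pose w (l : nat) : {poly {poly k}} := if (l < n)%N
  then (ev (x l))%:P%:P + 'X^(1 + (l < p)%N) * (X l)%:P
  else (ev (y (l - n)%N))%:P%:P + 'X^(1 + (l - n < q)%N) * (Y (l - n)%N)%:P.
have [||Psi [Psi0 Psiw]] := @mpoly_lift K (n + m) {poly k} {poly {poly k}}
  (polyC \o ev) (horner_eval 0) polyC w.
- by move=> f; rewrite /= /horner_eval hornerC.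
- move=> l lt; rewrite /= /horner_eval /w; case: ltnP => ln.
    by rewrite hornerD hornerM hornerXn !hornerC expr0n /= mul0r addr0.
  rewrite hornerD hornerM hornerXn !hornerC expr0n /= mul0r addr0.
  by rewrite /y subnKC.
pose G0 (P : 'I_n * 'I_m) : {poly k} := if C P.1 P.2 then
  (if (P.1 < p)%N then X P.1 * (ev (y P.2))%:P else 0) +
  (if (P.2 < q)%N then (ev (x P.1))%:P * Y P.2 else 0) +
  (if (p <= P.1)%N && (q <= P.2)%N then X P.1 * Y P.2 else 0) else 0.
have Gex (P : 'I_n * 'I_m) :
    exists g, Psi (cell_gen C x y P) = 'X^2 * g /\ g.[0] = G0 P.
  rewrite /cell_gen /G0; case: ifP => CP; last by exists 0; rewrite rmorph0 mulr0 horner0.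
  rewrite rmorphM !Psiw; last 2 first.
  - by rewrite ltn_add2l.
  - by rewrite ltn_addr.
  rewrite /w ltn_ord [(n + P.2 < n)%N]ltnNge leq_addr /= addKn.
  have [Pp|Pp] := ltnP P.1 p; have [Pq|Pq] := ltnP P.2 q.
  - rewrite x0 // y0 // !polyC0 !add0r mul0r mulr0 !addr0 addn1.
    exists ('X^2 * ((X P.1)%:P * (Y P.2)%:P)); split; first by ring.
    by rewrite hornerM hornerXn expr0n mul0r.
  - rewrite x0 // !polyC0 !add0r !addr0 addn1 addn0 expr1.
    exists ((X P.1)%:P * ((ev (y P.2))%:P%:P + 'X * (Y P.2)%:P)); split; first by ring.
    by rewrite !hornerE.
  - rewrite y0 // !polyC0 !add0r !addr0 addn1 addn0 expr1.
    exists (((ev (x P.1))%:P%:P + 'X * (X P.1)%:P) * (Y P.2)%:P); split; first by ring.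
    by rewrite !hornerE.
  have -> : ev (x P.1) = 0 by apply: contraTeq Pq => /(yq P.2 P.1 CP); rewrite ltnNge.
  have -> : ev (y P.2) = 0 by apply: contraTeq Pp => /(xp P.1 P.2 CP); rewrite ltnNge.
  rewrite !polyC0 !add0r addn0 expr1.
  exists ((X P.1)%:P * (Y P.2)%:P); split; first by ring.
  by rewrite !hornerE.
have [G GP] := choice Gex.
exists Psi, G; split=> [P|z]; first exact: (GP P).1.
pose D0 e := \sum_(P : 'I_n * 'I_m | (P.1 + e == P.2 + n)%N) G0 P.
pose C' i j := [&& C i j, (p <= i)%N & (q <= j)%N].
have D0E e : D0 e = (linD e)%:P * 'X + diag n m C' X0 Y0 e.
  rewrite /D0 /linD rmorph_sum mulr_suml /diag -big_split; apply: eq_bigr => P _.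
  rewrite /G0 /lin /cell_gen /C' /=; case: (C P.1 P.2); last by rewrite polyC0 mul0r add0r.
  rewrite /X /Y; have [Pp|Pp] := ltnP P.1 p; have [Pq|Pq] := ltnP P.2 q;
    rewrite /= ?polyCD ?polyCM ?polyC0; ring.
have D0P e : (e < n + m)%N -> exists kap : k,
    'X^M %| D0 e - (kap%:P + (phi (diag n m C x y e))%:P * 'X).
  (* A diagonal that misses the remaining tableau leaves nothing to adjust; there [diag_functional]
     shows that [linD e] is already the value of [phi]. *)
  move=> en; have [[i [j [Cij ie pi qj]]]|nomid] := pselect (exists i j,
      [/\ C i j, (i + e = j + n)%N, (p <= i)%N & (q <= j)%N]).
    exists (c e); rewrite D0E; have := XYP e i j Cij pi qj ie.
    rewrite polyCB -/C'; congr (_ %| _); ring.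
  exists 0; rewrite D0E.
  have -> : diag n m C' X0 Y0 e = 0.
    rewrite /diag big1 // => P /eqP Pe; rewrite /cell_gen; case: ifP => // /and3P[CP pP qP].
    by case: nomid; exists P.1, P.2.
  rewrite (diag_functional (p := p) (q := q) (u := u) (v := v) (r1 := r1) (r2 := r2) iJ semi) //.
  - by rewrite -/(linD e) polyC0 add0r addr0 subrr dvdp0.
  - by apply: mem_ideal_gen; exists (Ordinal en).
  - move=> i j Cij ie; apply: contra_notT nomid; rewrite negb_or -!leqNgt => /andP[pi qj].
    by exists i, j.
have [kap kapP] := choice (fun e : 'I_(n + m) => D0P e (ltn_ord e)).
move=> /fam_ideal_coef[a ->].
exists (\sum_e Psi (a e) * \sum_(P : 'I_n * 'I_m | (P.1 + e == P.2 + n)%N) G P),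
  (\sum_e ev (a e) * kap e); split.
  rewrite rmorph_sum mulr_sumr; apply: eq_bigr => e _.
  rewrite rmorphM mulrCA; congr (_ * _); rewrite /diag rmorph_sum mulr_sumr.
  by apply: eq_bigr => P _; rewrite (GP P).1.
have JD (e : 'I_(n + m)) : J (diag n m C x y e) by apply: mem_ideal_gen; exists e.
have -> : phi (\sum_e a e * diag n m C x y e) = \sum_e ev (a e) * phi (diag n m C x y e).
  rewrite (semilinear_sum _ iJ semi) => [|e _]; last exact: idealM.
  by apply: eq_bigr => e _; rewrite phiM.
have -> : (\sum_e Psi (a e) * \sum_(P : 'I_n * 'I_m | (P.1 + e == P.2 + n)%N) G P).[0] -
    ((\sum_e ev (a e) * kap e)%:P + (\sum_e ev (a e) * phi (diag n m C x y e))%:P * 'X) =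
    \sum_e (ev (a e))%:P * (D0 e - ((kap e)%:P + (phi (diag n m C x y e))%:P * 'X)).
  rewrite !rmorph_sum /= mulr_suml -big_split horner_sum -sumrB.
  apply: eq_bigr => e _; rewrite hornerM horner_sum.
  have -> : (Psi (a e)).[0] = (ev (a e))%:P by have := Psi0 (a e); rewrite /= /horner_eval.
  rewrite (eq_bigr G0) => [|P _]; last exact: (GP P).2.
  rewrite -/(D0 e) /= !polyCM; ring.
elim/big_ind: _ => [|f1 f2|e _]; [exact: dvdp0|exact: dvdp_add|].
exact: dvdp_mull.
Qed.

Lemma rmorph_kernel_is_ideal (R S : comNzRingType) (f : {rmorphism R -> S}) :
  is_ideal (fun a => f a = 0).
Proof.
split=> [|a b fa fb|r a fa]; first exact: rmorph0.
  by rewrite rmorphD fa fb addr0.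
by rewrite rmorphM fa mulr0.
Qed.

Lemma diags_minimal_reduction (K : fieldType) n m C :
  let x i := mvar K (n + m) i in let y j := mvar K (n + m) (n + j) in
  young n m C ->
  is_minimal_reduction (diags_ideal n m C x y) (cells_ideal n m C x y).
Proof.
move=> x y yC; split; first exact: diags_reduction.
set J := diags_ideal n m C x y; set I := cells_ideal n m C x y.
move=> J' iJ' J'J neq [_ [J'I [r red]]].
have iJ : is_ideal J by apply: ideal_gen_is_ideal.
have JD e : (e < n + m)%N -> J (diag n m C x y e).
  by move=> en; apply: mem_ideal_gen; exists (Ordinal en).
have exe : exists2 e, (e < n + m)%N & ~ J' (diag n m C x y e).
  apply: contrapT => nex; apply: neq => z; split; first exact: J'J.
  apply: ideal_gen_sub => // _ [e ->]; apply: contrapT => J'e; apply: nex.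
  by exists e.
have [k [ev [phi [semi phiJ' [e0 phie0]]]]] :=
  separating_functional (d := diag n m C x y) iJ' exe.
have phiJ z : J' z -> phi z = 0 by move=> J'z; apply: phiJ' => //; apply: J'J.
have [[i [j [Cij xi yj]]]|nocell] := pselect (exists i j,
    [/\ C i j, ev (x i) != 0 & ev (y j) != 0]); last first.
  apply: (@arc_contradiction _ k _ (@cell_gen _ n m C x y) J J' phi (diag n m C x y e0) r)
    => //.
  - exact: JD.
  - exact: diag_mem_cells_ideal.
  - by move=> z /red.
  - move=> M; apply: (ferrers_arc _ yC semi) => i j Cij.
    have [xi|xi] := eqVneq (ev (x i)) 0; first by left.
    have [yj|yj] := eqVneq (ev (y j)) 0; first by right.
    by case: nocell; exists i, j.
(* [J'] contains [I^(r+1)], hence a power of a cell that is nonzero at the point. Multiplying a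
   diagonal by [l] then contradicts the vanishing of [phi] on [J']. *)
have [l [J'l evl]] : exists l, J' l /\ ev l != 0.
  apply: contrapT => nl.
  have J'0 : ideal_sub J' (fun a => ev a = 0).
    move=> a J'a; apply: contrapT => /eqP eva; apply: nl; by exists a.
  have /andP[iN jM] := yC.1 _ _ Cij.
  pose P : 'I_n * 'I_m := (Ordinal iN, Ordinal jM).
  have := prod_mem_ideal_pow (@cell_gen _ n m C x y) (nseq r.+1 P).
  rewrite size_nseq => /red; set z := \prod_(_ <- _) _ => J'z.
  have : ev z = 0.
    move: z J'z; apply: ideal_gen_sub; first exact: rmorph_kernel_is_ideal.
    by move=> _ [a [b [/J'0 eva _ ->]]]; rewrite rmorphM eva mul0r.
  apply/eqP; rewrite rmorph_prod prodf_seq_neq0; apply/allP => Q /nseqP[-> _].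
  by rewrite /cell_gen /= Cij rmorphM mulf_neq0.
have /phiJ : J' (l * diag n m C x y e0) by apply: idealMl.
have [_ ->] := semi; last exact: JD.
by apply/eqP; rewrite mulf_neq0.
Qed.

(** * Ferrers ideals of partitions *)

Lemma partition_young lam :
  is_partition lam ->
  young (size lam) (head 0%N lam) (fun i j => (j < nth 0%N lam i)%N).
Proof.
move=> [srt _].
have nth_le i i' : (i' <= i)%N -> (nth 0%N lam i <= nth 0%N lam i')%N.
  move=> le; have [lt|ge] := ltnP i (size lam); last by rewrite nth_default.
  have geq_tr : transitive geq by move=> a b c ba cb; apply: leq_trans cb ba.
  have geq_refl : reflexive geq by move=> a; apply: leqnn.
  exact: (sorted_leq_nth geq_tr geq_refl 0%N srt i' i (leq_ltn_trans le lt) lt le).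
split=> [i j lt|i j i' j' lei lej lt].
  have [ilt|ige] := ltnP i (size lam); last by rewrite nth_default in lt.
  by rewrite -nth0 (leq_trans lt) // nth_le.
exact: leq_ltn_trans lej (leq_trans lt (nth_le _ _ lei)).
Qed.

Lemma ferrers_idealE (K : fieldType) lam :
  is_partition lam ->
  ferrers_ideal K lam =
  cells_ideal (size lam) (head 0%N lam) (fun i j => (j < nth 0%N lam i)%N) (fx K lam) (fy K lam).
Proof.
move=> /partition_young[Cb _]; apply/funext => z; apply/propext; split; move: z;
  (apply: ideal_gen_sub; first exact: ideal_gen_is_ideal) => z.
  case/allpairsPdep => a [b []]; rewrite !mem_iota !add0n /= => an ba ->.
  have /andP[_ bm] := Cb _ _ ba.
  apply: mem_ideal_gen; exists (Ordinal an, Ordinal bm).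
  by rewrite /cell_gen /= ba.
case=> P ->; rewrite /cell_gen; case: ifP => [ba|_].
  apply: mem_ideal_gen; apply/allpairsPdep; exists (val P.1), (val P.2).
  by rewrite !mem_iota !add0n /= ltn_ord.
by apply: ideal0; apply: ideal_gen_is_ideal.
Qed.

Lemma diagUE (K : fieldType) lam k :
  is_partition lam ->
  diagU K lam k = diag (size lam) (head 0%N lam) (fun i j => (j < nth 0%N lam i)%N)
    (fx K lam) (fy K lam) (k + size lam).
Proof.
move=> /partition_young yC; rewrite diagE // /diagU.
rewrite -{1}[size lam]subn0 -/(index_iota 0 (size lam)) big_mkord big_mkcond.
by apply: eq_bigr => i _; rewrite addnA leq_addl addnK.
Qed.

Lemma diagLE (K : fieldType) lam k :
  is_partition lam -> (k <= size lam)%N ->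
  diagL K lam k = diag (size lam) (head 0%N lam) (fun i j => (j < nth 0%N lam i)%N)
    (fx K lam) (fy K lam) (size lam - k).
Proof.
move=> /partition_young yC; rewrite diagE // /diagL; set n := size lam => kn.
rewrite -{1}[n]subn0 -/(index_iota 0 n).
under eq_bigl => b do rewrite andbC -ltn_subRL.
rewrite -(big_nat_widen 0 (n - k)%N n) ?leq_subr // big_mkcond /=.
pose F i := if (n <= i + (n - k))%N && (i + (n - k) - n < nth 0%N lam i)%N
  then fx K lam i * fy K lam (i + (n - k) - n) else 0.
(* Rows of index less than [k] have no cell on this diagonal; the others are reindexed by
   [b = i - k]. *)
rewrite -[RHS](big_mkord xpredT F) [RHS](big_cat_nat (n := k)) //=.
rewrite [X in _ = X + _]big_nat_cond [X in _ = X + _]big1 ?add0r; last first.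
  by move=> i /andP[/andP[_ ik] _]; rewrite /F leqNgt (_ : (_ < n)%N) //; lia.
rewrite -[k in RHS]add0n big_addn; apply: eq_bigr => b _.
rewrite /F [(b + k)%N]addnC -addnA [(b + _)%N]addnC addnA subnKC // leq_addr.
by rewrite addKn.
Qed.

Lemma diag_idealE (K : fieldType) lam :
  is_partition lam -> (0 < size lam)%N ->
  diag_ideal K lam =
  diags_ideal (size lam) (head 0%N lam) (fun i j => (j < nth 0%N lam i)%N) (fx K lam) (fy K lam).
Proof.
move=> plam n0; apply/funext => z; apply/propext; split; move: z;
  (apply: ideal_gen_sub; first exact: ideal_gen_is_ideal) => z.
  rewrite mem_cat => /orP[] /mapP[k]; rewrite mem_iota => kn ->.
    rewrite diagUE //; apply: mem_ideal_gen.
    have lt : (k + size lam < size lam + head 0%N lam)%N by lia.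
    by exists (Ordinal lt).
  rewrite diagLE //; last by lia.
  apply: mem_ideal_gen.
  have lt : (size lam - k < size lam + head 0%N lam)%N by lia.
  by exists (Ordinal lt).
(* Index [0] gives the empty diagonal. An index [e >= n] is the upper diagonal [e - n], and
   [0 < e < n] is the lower diagonal [n - e], where [n] is [size lam]. *)
case=> e ->; have [e0|e_gt0] := posnP e.
  rewrite /diag big1; first by apply: ideal0; apply: ideal_gen_is_ideal.
  move=> P /eqP; rewrite e0 addn0 => Pe; have := ltn_ord P.1.
  by rewrite Pe -[X in (_ < X)%N]add0n ltn_add2r ltn0.
apply: mem_ideal_gen; rewrite mem_cat; have [le|lt] := leqP (size lam) e.
  apply/orP; left; apply/mapP; exists (e - size lam)%N.
    by rewrite mem_iota; have := ltn_ord e; lia.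
  by rewrite diagUE // subnK.
apply/orP; right; apply/mapP; exists (size lam - e)%N.
  by rewrite mem_iota; lia.
by rewrite diagLE ?leq_subr // subKn // ltnW.
Qed.

Theorem theorem5p1 (K : fieldType) (lam : seq nat) :
  is_partition lam -> (0 < size lam)%N ->
  is_minimal_reduction (diag_ideal K lam) (ferrers_ideal K lam).
Proof.
move=> plam n0; rewrite diag_idealE // ferrers_idealE //.
exact: diags_minimal_reduction (partition_young plam).
Qed.
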